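(* Let $H$ be a Hopf algebra in $\mathcal C$, $A$ an algebra in $\mathcal C$, and let $(\varphi_A,\omega)$, with $\varphi_A:H\otimes A\to A$ and $\omega:H\otimes H\to A$, be a twisted partial action of $H$ on $A$ satisfying the partial cocycle condition $$\mu_{A}\circ (A\otimes \omega)\circ (\psi_{H}^{A}\otimes H)\circ (H\otimes \sigma_{H}^{A})=\mu_{A}\circ (A\otimes \omega)\circ (\sigma_{H}^{A}\otimes H)$$ and the unit conditions $$\omega\circ (H\otimes \eta_{H})=\omega\circ (\eta_{H}\otimes H)=\varphi_{A}\circ (H\otimes \eta_{A}),$$ where $\psi_{H}^{A}=(\varphi_{A}\otimes H)\circ (H\otimes c_{H,A})\circ (\delta_{H}\otimes A)$ and $\sigma_{H}^{A}=(\omega\otimes \mu_{H})\circ \delta_{H\otimes H}$. Let $\mu_{A\otimes H} = (\mu_A\otimes H)\circ (\mu_A\otimes \sigma_{H}^{A})\circ (A\otimes \psi_{H}^{A}\otimes H)$ and $\nu=\eta_A\otimes\eta_H$. Then $\nu$ is a preunit for $\mu_{A\otimes H}$, the pair $(A\otimes H,\mu_{A\otimes H})$ is a weak crossed product with preunit $\nu$, $\nabla^{\nu}_{A\otimes H}=\nabla_{A\otimes H}$, and $A\times H$, with the product $\mu_{A\times H}=p_{A\otimes H}\circ\mu_{A\otimes H}\circ(i_{A\otimes H}\otimes i_{A\otimes H})$, is an algebra with unit $\eta_{A\times H}=p_{A\otimes H}\circ\nu$.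
   Context: $\mathcal C$ is a strict braided monoidal category with tensor product $\otimes$, base object $K$ and braiding $c$, in which every idempotent splits. For an object $X$ and a morphism $f$, $X\otimes f$ means $id_X\otimes f$ and $f\otimes X$ means $f\otimes id_X$. Algebras $(A,\eta_A,\mu_A)$ (unital, associative), coalgebras $(D,\varepsilon_D,\delta_D)$, bialgebras and Hopf algebras are taken in $\mathcal C$. $\delta_{H\otimes H}=(H\otimes c_{H,H}\otimes H)\circ(\delta_H\otimes\delta_H)$. Twisted partial action: a pair $(\varphi_A:H\otimes A\to A,\ \omega:H\otimes H\to A)$ such that (i) $\varphi_{A}\circ (\eta_{H}\otimes A)=id_{A}$; (ii) $\varphi_{A}\circ (H\otimes \mu_{A})=\mu_{A}\circ (\varphi_{A}\otimes \varphi_{A})\circ (H\otimes c_{H,A}\otimes A)\circ (\delta_{H}\otimes A\otimes A)$; (iii) $\mu_{A}\circ (A\otimes \omega)\circ (\psi_{H}^{A}\otimes H)\circ (H\otimes \psi_{H}^{A})=\mu_{A}\circ (A\otimes \varphi_{A})\circ (\sigma_{H}^{A}\otimes A)$; (iv) $\omega=\mu_{A}\circ (A\otimes \varphi_{A})\circ (\sigma_{H}^{A}\otimes \eta_{A})$; with $\psi_H^A,\sigma_H^A$ given by the formulas in the claim. Weak crossed product: let $A$ be an algebra, $V$ an object, $\psi_V^A:V\otimes A\to A\otimes V$ and $\sigma_V^A:V\otimes V\to A\otimes V$ morphisms with $(\mu_A\otimes V)\circ (A\otimes \psi_{V}^{A})\circ(\psi_{V}^{A}\otimes A) = \psi_{V}^{A}\circ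 (V\otimes \mu_A)$. Then $\nabla_{A\otimes V} = (\mu_A\otimes V)\circ(A\otimes\psi_{V}^{A})\circ (A\otimes V\otimes \eta_A)$ is idempotent; $A\times V$, $i_{A\otimes V}:A\times V\to A\otimes V$, $p_{A\otimes V}:A\otimes V\to A\times V$ denote the object, injection and projection of its splitting ($\nabla_{A\otimes V}=i_{A\otimes V}\circ p_{A\otimes V}$, $p_{A\otimes V}\circ i_{A\otimes V}=id$). For all quadruples $(A,V,\psi_V^A,\sigma_V^A)$ one requires $\nabla_{A\otimes V}\circ\sigma_V^A=\sigma_V^A$. The twisted condition is $(\mu_A\otimes V)\circ (A\otimes \psi_{V}^{A})\circ(\sigma_{V}^{A}\otimes A) = (\mu_A\otimes V)\circ (A\otimes\sigma_{V}^{A})\circ (\psi_{V}^{A}\otimes V)\circ (V\otimes\psi_{V}^{A})$, and the cocycle condition is $(\mu_A\otimes V)\circ (A\otimes \sigma_{V}^{A}) \circ(\sigma_{V}^{A}\otimes V) = (\mu_A\otimes V)\circ (A\otimes\sigma_{V}^{A})\circ (\psi_{V}^{A}\otimes V)\circ(V\otimes\sigma_{V}^{A})$. If both hold, $(A\otimes V,\mu_{A\otimes V})$ with $\mu_{A\otimes V}=(\mu_A\otimes V)\circ (\mu_A\otimes\sigma_{V}^{A})\circ (A\otimes \psi_{V}^{A}\otimes V)$ is called a weak crossed product. Preunit: for an associative product $m$ on $A\otimes V$, a morphism $\nu:K\to A\otimes V$ with $m\circ (A\otimes V\otimes \nu)=m\circ (\nu\otimes A\otimes V)=m\circ (A\otimes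 V\otimes (m\circ(\nu\otimes \nu)))$; the associated idempotent is $\nabla_{A\otimes V}^{\nu}=m\circ (A\otimes V\otimes \nu)$. A weak crossed product with preunit $\nu$ is a weak crossed product satisfying $(\mu_A\otimes V)\circ (A\otimes \sigma_{V}^{A})\circ(\psi_{V}^{A}\otimes V)\circ (V\otimes \nu) =\nabla_{A\otimes V}\circ(\eta_A\otimes V)$, $(\mu_A\otimes V)\circ (A\otimes \sigma_{V}^{A})\circ(\nu\otimes V) = \nabla_{A\otimes V}\circ (\eta_A\otimes V)$, and $(\mu_A\otimes V)\circ (A\otimes \psi_{V}^{A})\circ (\nu\otimes A)=\beta_\nu$, where $\beta_\nu=(\mu_A\otimes V)\circ(A\otimes\nu):A\to A\otimes V$. *)

(* Defs.v *)
From mathcomp Require Import ssreflect ssrfun.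

Set Implicit Arguments.
Unset Strict Implicit.
Unset Printing Implicit Defensive.

Declare Scope ob_scope.
Declare Scope hom_scope.
Delimit Scope ob_scope with ob.
Delimit Scope hom_scope with hom.

Record category := Category {
  ob :> Type;
  hom : ob -> ob -> Type;
  idm : forall X, hom X X;
  compm : forall X Y Z, hom Y Z -> hom X Y -> hom X Z;
  comp1m : forall X Y (f : hom X Y), compm (idm Y) f = f;
  compm1 : forall X Y (f : hom X Y), compm f (idm X) = f;
  compmA : forall X Y Z W (h : hom Z W) (g : hom Y Z) (f : hom X Y),
    compm h (compm g f) = compm (compm h g) f
}.

Arguments hom {c} X%_ob Y%_ob.
Arguments idm {c} X%_ob.
Arguments compm {c X Y Z} g%_hom f%_hom.

Bind Scope ob_scope with ob.
Bind Scope hom_scope with hom.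

(* As usual, an object stands for its identity: [X ⊗ f] is [idm X ⊗ f]. *)
Coercion idm : ob >-> hom.

Definition castm (C : category) (X X' Y Y' : C) (eX : X = X') (eY : Y = Y')
    (f : hom X Y) : hom X' Y' :=
  match eX in _ = X0, eY in _ = Y0 return hom X0 Y0 with
  | erefl, erefl => f
  end.

(* Associativity and unitality of the tensor product are equalities of        *)
(* objects, and the corresponding equations on morphisms hold along them,     *)
(* i.e., the associativity and unit constraints are identities.               *)
Record strictMonoidal := StrictMonoidal {
  sm_cat :> category;
  tens : sm_cat -> sm_cat -> sm_cat;
  base : sm_cat;
  tensm : forall X Y X' Y' : sm_cat,
    hom X Y -> hom X' Y' -> hom (tens X X') (tens Y Y');
  tensA : forall X Y Z, tens X (tens Y Z) = tens (tens X Y) Z;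
  tens1o : forall X, tens base X = X;
  tenso1 : forall X, tens X base = X;
  tensm_id : forall X Y : sm_cat, tensm (idm X) (idm Y) = idm (tens X Y);
  tensm_comp : forall (X Y Z X' Y' Z' : sm_cat)
      (g : hom Y Z) (f : hom X Y) (g' : hom Y' Z') (f' : hom X' Y'),
    tensm (compm g f) (compm g' f') = compm (tensm g g') (tensm f f');
  tensmA : forall (X Y X' Y' X'' Y'' : sm_cat)
      (f : hom X Y) (g : hom X' Y') (h : hom X'' Y''),
    castm (tensA _ _ _) (tensA _ _ _) (tensm f (tensm g h)) =
      tensm (tensm f g) h;
  tens1m : forall (X Y : sm_cat) (f : hom X Y),
    castm (tens1o _) (tens1o _) (tensm (idm base) f) = f;
  tensm1 : forall (X Y : sm_cat) (f : hom X Y),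
    castm (tenso1 _) (tenso1 _) (tensm f (idm base)) = f
}.

Arguments tens {s} X%_ob Y%_ob.
Arguments base {s}.
Arguments tensm {s X Y X' Y'} f%_hom g%_hom.

Notation "X ⊗ Y" := (tens X Y) (at level 40, left associativity) : ob_scope.
Notation "f ⊗ g" := (tensm f g) (at level 40, left associativity) : hom_scope.

(* Object equalities that follow from strictness. Morphisms are composed and  *)
(* compared along them: the class argument of [scomp] and [recast] is found   *)
(* by rewriting with [tensA], [tens1o] and [tenso1], so that formulas can     *)
(* disregard bracketing and tensor factors [base]. Up to proof irrelevance    *)
(* nothing depends on which proof of the object equality is found.            *)
Class sameob (C : strictMonoidal) (X Y : C) : Prop := sameobE : X = Y.

Ltac solve_sameob :=
  rewrite /sameob ?tens1o ?tenso1 ?tensA ?tens1o ?tenso1; reflexivity.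

#[export] Hint Extern 0 (@sameob _ _ _) => reflexivity : typeclass_instances.
#[export] Hint Extern 1 (@sameob _ _ _) => solve_sameob : typeclass_instances.

Definition recast (C : strictMonoidal) (X X' Y Y' : C)
    {eX : sameob X X'} {eY : sameob Y Y'} (f : hom X Y) : hom X' Y' :=
  castm eX eY f.

Arguments recast {C X X' Y Y' eX eY} f%_hom.

Definition scomp (C : strictMonoidal) (X Y Y' Z : C) {e : sameob Y Y'}
    (g : hom Y' Z) (f : hom X Y) : hom X Z :=
  compm g (castm erefl e f).

Arguments scomp {C X Y Y' Z e} g%_hom f%_hom.

Notation "g ∘ f" := (scomp g f) (at level 50, left associativity) : hom_scope.
Notation "f ≡ g" := (recast f%hom = g%hom)
  (at level 70, no associativity) : type_scope.

Record strictBraided := StrictBraided {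
  sb_monoidal :> strictMonoidal;
  braid : forall X Y : sb_monoidal, hom (X ⊗ Y) (Y ⊗ X);
  braid_inv : forall X Y : sb_monoidal, hom (Y ⊗ X) (X ⊗ Y);
  braidK : forall X Y, braid_inv X Y ∘ braid X Y ≡ idm (X ⊗ Y);
  braid_invK : forall X Y, braid X Y ∘ braid_inv X Y ≡ idm (Y ⊗ X);
  braid_nat : forall (X Y X' Y' : sb_monoidal) (f : hom X X') (g : hom Y Y'),
    (g ⊗ f) ∘ braid X Y ≡ braid X' Y' ∘ (f ⊗ g);
  braid_tensl : forall X Y Z : sb_monoidal,
    braid (X ⊗ Y)%ob Z ≡ (braid X Z ⊗ Y) ∘ (X ⊗ braid Y Z);
  braid_tensr : forall X Y Z : sb_monoidal,
    braid X (Y ⊗ Z)%ob ≡ (Y ⊗ braid X Z) ∘ (braid X Y ⊗ Z)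
}.

Arguments braid {s} X%_ob Y%_ob.
Arguments braid_inv {s} X%_ob Y%_ob.

Definition is_splitting (C : category) (X P : C) (f : hom X X)
    (i : hom P X) (p : hom X P) : Prop :=
  f = compm i p /\ compm p i = idm P.

Definition idempotents_split (C : category) : Prop :=
  forall (X : C) (f : hom X X), compm f f = f ->
  exists (P : C) (i : hom P X) (p : hom X P), is_splitting f i p.

Definition associative_product (C : strictMonoidal) (B : C)
    (m : hom (B ⊗ B) B) : Prop :=
  m ∘ (m ⊗ B) ≡ m ∘ (B ⊗ m).

Record is_algebra (C : strictMonoidal) (B : C)
    (u : hom base B) (m : hom (B ⊗ B) B) : Prop := IsAlgebra {
  is_alg_assoc : associative_product m;
  is_alg_unitl : m ∘ (u ⊗ B) ≡ idm B;
  is_alg_unitr : m ∘ (B ⊗ u) ≡ idm B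
}.

Record algebra (C : strictMonoidal) := Algebra {
  alg_ob :> ob C;
  unit_ : hom base alg_ob;
  mul_ : hom (alg_ob ⊗ alg_ob) alg_ob;
  algP : is_algebra unit_ mul_
}.

Record is_coalgebra (C : strictMonoidal) (D : C)
    (e : hom D base) (d : hom D (D ⊗ D)) : Prop := IsCoalgebra {
  is_coalg_coassoc : (d ⊗ D) ∘ d ≡ (D ⊗ d) ∘ d;
  is_coalg_counitl : (e ⊗ D) ∘ d ≡ idm D;
  is_coalg_counitr : (D ⊗ e) ∘ d ≡ idm D
}.

Arguments unit_ {C} A : rename.
Arguments mul_ {C} A : rename.
Notation "'η_' A" := (unit_ A) (at level 8, A at level 2, format "'η_' A").
Notation "'μ_' A" := (mul_ A) (at level 8, A at level 2, format "'μ_' A").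
Notation "'c_(' X , Y )" := (braid X Y) (at level 8, format "'c_(' X ,  Y )").

(* The counit and the comultiplication are algebra morphisms. *)
Record hopfAlgebra (C : strictBraided) := HopfAlgebra {
  hopf_alg :> algebra C;
  counit : hom hopf_alg base;
  comul : hom hopf_alg (hopf_alg ⊗ hopf_alg);
  antipode : hom hopf_alg hopf_alg;
  hopf_coalgP : is_coalgebra counit comul;
  counit_unit : counit ∘ η_ hopf_alg ≡ idm base;
  counit_mul : counit ∘ μ_ hopf_alg ≡ counit ⊗ counit;
  comul_unit : comul ∘ η_ hopf_alg ≡ η_ hopf_alg ⊗ η_ hopf_alg;
  comul_mul : comul ∘ μ_ hopf_alg ≡
    (μ_ hopf_alg ⊗ μ_ hopf_alg) ∘ (hopf_alg ⊗ c_(hopf_alg, hopf_alg) ⊗ hopf_alg)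
      ∘ (comul ⊗ comul);
  antipodel : μ_ hopf_alg ∘ (antipode ⊗ hopf_alg) ∘ comul ≡
    η_ hopf_alg ∘ counit;
  antipoder : μ_ hopf_alg ∘ (hopf_alg ⊗ antipode) ∘ comul ≡
    η_ hopf_alg ∘ counit
}.

Arguments counit {C} H : rename.
Arguments comul {C} H : rename.
Arguments antipode {C} H : rename.
Notation "'ε_' H" := (counit H) (at level 8, H at level 2, format "'ε_' H").
Notation "'δ_' H" := (comul H) (at level 8, H at level 2, format "'δ_' H").

Definition comul2 (C : strictBraided) (H : hopfAlgebra C) :
    hom (H ⊗ H) (H ⊗ H ⊗ H ⊗ H) :=
  recast ((H ⊗ c_(H, H) ⊗ H) ∘ (δ_ H ⊗ δ_ H)).

Definition psi_of (C : strictBraided) (H : hopfAlgebra C) (A : algebra C)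
    (phi : hom (H ⊗ A) A) : hom (H ⊗ A) (A ⊗ H) :=
  recast ((phi ⊗ H) ∘ (H ⊗ c_(H, A)) ∘ (δ_ H ⊗ A)).

Definition sigma_of (C : strictBraided) (H : hopfAlgebra C) (A : algebra C)
    (omega : hom (H ⊗ H) A) : hom (H ⊗ H) (A ⊗ H) :=
  recast ((omega ⊗ μ_ H) ∘ comul2 H).

Record twisted_partial_action (C : strictBraided) (H : hopfAlgebra C)
    (A : algebra C) (phi : hom (H ⊗ A) A) (omega : hom (H ⊗ H) A) : Prop :=
  TwistedPartialAction {
  tpa_unit : phi ∘ (η_ H ⊗ A) ≡ idm A;
  tpa_mul : phi ∘ (H ⊗ μ_ A) ≡
    μ_ A ∘ (phi ⊗ phi) ∘ (H ⊗ c_(H, A) ⊗ A) ∘ (δ_ H ⊗ A ⊗ A);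
  tpa_twisted :
    μ_ A ∘ (A ⊗ omega) ∘ (psi_of phi ⊗ H) ∘ (H ⊗ psi_of phi) ≡
    μ_ A ∘ (A ⊗ phi) ∘ (sigma_of omega ⊗ A);
  tpa_omega : omega ≡ μ_ A ∘ (A ⊗ phi) ∘ (sigma_of omega ⊗ η_ A)
}.

Definition partial_cocycle (C : strictBraided) (H : hopfAlgebra C)
    (A : algebra C) (phi : hom (H ⊗ A) A) (omega : hom (H ⊗ H) A) : Prop :=
  μ_ A ∘ (A ⊗ omega) ∘ (psi_of phi ⊗ H) ∘ (H ⊗ sigma_of omega) ≡
  μ_ A ∘ (A ⊗ omega) ∘ (sigma_of omega ⊗ H).

Definition nabla (C : strictMonoidal) (A : algebra C) (V : C)
    (psi : hom (V ⊗ A) (A ⊗ V)) : hom (A ⊗ V) (A ⊗ V) :=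
  recast ((μ_ A ⊗ V) ∘ (A ⊗ psi) ∘ (A ⊗ V ⊗ η_ A)).

Definition wcp_mul (C : strictMonoidal) (A : algebra C) (V : C)
    (psi : hom (V ⊗ A) (A ⊗ V)) (sigma : hom (V ⊗ V) (A ⊗ V)) :
    hom ((A ⊗ V) ⊗ (A ⊗ V)) (A ⊗ V) :=
  recast ((μ_ A ⊗ V) ∘ (μ_ A ⊗ sigma) ∘ (A ⊗ psi ⊗ V)).

(* [wcp_psi_mul] and [wcp_nabla_sigma] are the standing requirements on a     *)
(* quadruple (A, V, psi, sigma).                                              *)
Record weak_crossed_product (C : strictMonoidal) (A : algebra C) (V : C)
    (psi : hom (V ⊗ A) (A ⊗ V)) (sigma : hom (V ⊗ V) (A ⊗ V)) : Prop :=
  WeakCrossedProduct {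
  wcp_psi_mul :
    (μ_ A ⊗ V) ∘ (A ⊗ psi) ∘ (psi ⊗ A) ≡ psi ∘ (V ⊗ μ_ A);
  wcp_nabla_sigma : nabla psi ∘ sigma ≡ sigma;
  wcp_twisted :
    (μ_ A ⊗ V) ∘ (A ⊗ psi) ∘ (sigma ⊗ A) ≡
    (μ_ A ⊗ V) ∘ (A ⊗ sigma) ∘ (psi ⊗ V) ∘ (V ⊗ psi);
  wcp_cocycle :
    (μ_ A ⊗ V) ∘ (A ⊗ sigma) ∘ (sigma ⊗ V) ≡
    (μ_ A ⊗ V) ∘ (A ⊗ sigma) ∘ (psi ⊗ V) ∘ (V ⊗ sigma)
}.

Record is_preunit (C : strictMonoidal) (B : C)
    (m : hom (B ⊗ B) B) (nu : hom base B) : Prop := IsPreunit {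
  preunit_assoc : associative_product m;
  preunit_comm : m ∘ (B ⊗ nu) ≡ m ∘ (nu ⊗ B);
  preunit_idem : m ∘ (nu ⊗ B) ≡ m ∘ (B ⊗ (m ∘ (nu ⊗ nu)))
}.

Definition nabla_preunit (C : strictMonoidal) (B : C)
    (m : hom (B ⊗ B) B) (nu : hom base B) : hom B B :=
  recast (m ∘ (B ⊗ nu)).

Definition beta (C : strictMonoidal) (A : algebra C) (V : C)
    (nu : hom base (A ⊗ V)) : hom A (A ⊗ V) :=
  recast ((μ_ A ⊗ V) ∘ (A ⊗ nu)).

Record weak_crossed_product_with_preunit (C : strictMonoidal) (A : algebra C)
    (V : C) (psi : hom (V ⊗ A) (A ⊗ V)) (sigma : hom (V ⊗ V) (A ⊗ V))
    (nu : hom base (A ⊗ V)) : Prop := WeakCrossedProductWithPreunit {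
  wcpp_wcp : weak_crossed_product psi sigma;
  wcpp_sigma_right :
    (μ_ A ⊗ V) ∘ (A ⊗ sigma) ∘ (psi ⊗ V) ∘ (V ⊗ nu) ≡
    nabla psi ∘ (η_ A ⊗ V);
  wcpp_sigma_left :
    (μ_ A ⊗ V) ∘ (A ⊗ sigma) ∘ (nu ⊗ V) ≡ nabla psi ∘ (η_ A ⊗ V);
  wcpp_psi : (μ_ A ⊗ V) ∘ (A ⊗ psi) ∘ (nu ⊗ A) ≡ beta nu
}.

(* Main.v *)
(* Morphisms are packed with their domain and codomain, so that associativity   *)
(* and unitality of the tensor product become Leibniz equalities, and composite *)
(* morphisms are computed with as string diagrams, i.e., up to interchange.     *)
(*                                                                              *)
(* Both psi and sigma are H-colinear: (A ⊗ δ) ∘ psi = (psi ⊗ H) ∘ (H ⊗ c) ∘     *)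
(* (δ ⊗ A) by coassociativity, and (A ⊗ δ) ∘ sigma = (sigma ⊗ μ) ∘ δ_(H ⊗ H)    *)
(* since δ is multiplicative. Expanding the last psi or sigma of a composite    *)
(* and moving its δ towards the inputs by colinearity thus turns an equation    *)
(* with values in A ⊗ H into the corresponding axiom with values in A. This     *)
(* gives the twisted and cocycle conditions, and the other two requirements on  *)
(* the quadruple. The unit conditions on omega say that sigma ∘ (H ⊗ η) and     *)
(* sigma ∘ (η ⊗ H) are both psi ∘ (H ⊗ η), which yields the preunit conditions. *)
(* The remaining claims hold for every weak crossed product with preunit.       *)

From mathcomp Require Import all_boot.
From mathcomp Require Import zify.
From Stdlib Require Import ClassicalEpsilon ProofIrrelevance.
Require Import Defs.

Set Implicit Arguments.
Unset Strict Implicit.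
Unset Printing Implicit Defensive.

(** * Morphisms packed with their domain and codomain *)

(** The mathematical content lies in a few equations. Colinearity ([psi_colinear], [sigma_colinear])
    reduces [tpa_psi_mul], [tpa_nabla_sigma], [tpa_wcp_twisted] and [tpa_wcp_cocycle] to axioms
    (ii), (iv), (iii) and the partial cocycle condition respectively. The unit conditions enter
    through [sigma_unitr] and [sigma_unitl], axiom (i) through [psi_unit]. In any weak crossed
    product with preunit, multiplication by ν on either side is the idempotent ∇, which makes ν a
    preunit ([wcp_preunit]); on the image of ∇ it becomes a unit ([split_algebra]).

    Each equation is checked by reflection. A composite is flattened to a list of boxes at
    positions, rewritten with known equations, and compared up to interchange. The searches only
    have to be sound: every move preserves the relation [denotes], which determines the arrow
    ([denotes_fun]), and [diagrammatic] returns the equation of morphisms. *)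

Record arrow (C : category) := Arrow { src : C; tgt : C; mor : hom src tgt }.
Arguments Arrow {C src tgt} mor%_hom.

Section Arrow.
Variable C : strictMonoidal.
Implicit Types F G K : arrow C.

Definition gid (X : C) : arrow C := Arrow (idm X).

(* The junk value [F] is returned when [F] and [G] are not composable. *)
Definition gcomp G F : arrow C :=
  match excluded_middle_informative (tgt F = src G) with
  | left e => Arrow (compm (mor G) (castm erefl e (mor F)))
  | right _ => F
  end.

Definition gtens F G : arrow C := Arrow (mor F ⊗ mor G).

Lemma Arrow_castm (X X' Y Y' : C) (eX : X = X') (eY : Y = Y') (f : hom X Y) :
  Arrow (castm eX eY f) = Arrow f.
Proof. by case: X' / eX; case: Y' / eY. Qed.

Lemma Arrow_recast (X X' Y Y' : C) (eX : sameob X X') (eY : sameob Y Y')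
    (f : hom X Y) :
  Arrow (recast f) = Arrow f.
Proof. exact: Arrow_castm. Qed.

(** Proof irrelevance makes dependent pairs injective; this brings equations between packed arrows
    back to morphisms. *)
Lemma Arrow_inj (X Y : C) : injective (fun f : hom X Y => Arrow f).
Proof.
move=> f g [] /(@inj_pairT2 _ _ _ _ _) fg.
exact: (inj_pairT2 _ _ _ _ _ fg).
Qed.

Lemma eq_recast (X X' Y Y' : C) (eX : sameob X X') (eY : sameob Y Y')
    (f : hom X Y) (g : hom X' Y') :
  Arrow f = Arrow g -> recast f = g.
Proof. by move=> fg; apply: Arrow_inj; rewrite Arrow_recast. Qed.

Lemma Arrow_scomp (X Y Y' Z : C) (e : sameob Y Y') (g : hom Y' Z)
    (f : hom X Y) :
  Arrow (g ∘ f) = gcomp (Arrow g) (Arrow f).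
Proof.
rewrite /gcomp; case: excluded_middle_informative => // e' /=.
by rewrite (proof_irrelevance _ e e').
Qed.

Lemma Arrow_compm (X Y Z : C) (g : hom Y Z) (f : hom X Y) :
  Arrow (compm g f) = gcomp (Arrow g) (Arrow f).
Proof. exact: (@Arrow_scomp X Y Y Z erefl g f). Qed.

Lemma src_gcomp G F : src (gcomp G F) = src F.
Proof. by rewrite /gcomp; case: excluded_middle_informative. Qed.

Lemma tgt_gcomp G F : tgt F = src G -> tgt (gcomp G F) = tgt G.
Proof. by rewrite /gcomp; case: excluded_middle_informative. Qed.

Lemma gcompA K G F : tgt F = src G -> tgt G = src K ->
  gcomp K (gcomp G F) = gcomp (gcomp K G) F.
Proof.
case: F G K => [X Y f] [Y' Z g] [Z' W h] /= eY eZ.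
case: Y' / eY g => g; case: Z' / eZ h => h.
by rewrite -!Arrow_compm compmA.
Qed.

Lemma gcomp1g X F : tgt F = X -> gcomp (gid X) F = F.
Proof.
by case: F => [Y Z f] /= eZ; case: X / eZ; rewrite -Arrow_compm comp1m.
Qed.

Lemma gcompg1 X F : src F = X -> gcomp F (gid X) = F.
Proof.
by case: F => [Y Z f] /= eY; case: X / eY; rewrite -Arrow_compm compm1.
Qed.

Lemma gtens_comp G F G' F' : tgt F = src G -> tgt F' = src G' ->
  gtens (gcomp G F) (gcomp G' F') = gcomp (gtens G G') (gtens F F').
Proof.
case: F G F' G' => [X Y f] [Y' Z g] [U V f'] [V' W g'] /= eY eV.
case: Y' / eY g => g; case: V' / eV g' => g'.
by rewrite -!Arrow_compm -tensm_comp.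
Qed.

Lemma gtens_id X Y : gtens (gid X) (gid Y) = gid (X ⊗ Y)%ob.
Proof. by rewrite /gtens /= tensm_id. Qed.

Lemma gtensA F G K : gtens F (gtens G K) = gtens (gtens F G) K.
Proof. by rewrite /gtens /= -tensmA Arrow_castm. Qed.

Lemma gtens1g F : gtens (gid base) F = F.
Proof.
case: F => X Y f; rewrite /gtens /= -[in RHS](tens1m f).
by rewrite Arrow_castm.
Qed.

Lemma gtensg1 F : gtens F (gid base) = F.
Proof.
case: F => X Y f; rewrite /gtens /= -[in RHS](tensm1 f).
by rewrite Arrow_castm.
Qed.

End Arrow.

(** * String diagrams *)

Section Words.
Variables (C : strictMonoidal) (atoms : seq C).

Definition word := seq nat.

Definition word_ob (w : word) : C :=
  foldr (fun a X => tens (nth base atoms a) X) base w.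

Lemma word_ob_cat u v : word_ob (u ++ v) = tens (word_ob u) (word_ob v).
Proof. by elim: u => [|a u IH] /=; rewrite ?tens1o // IH tensA. Qed.

Class atom_index (X : C) (s : seq C) (n : nat) :=
  nth_atom_index : nth base s n = X.

Class is_word (X : C) (w : word) := is_wordE : X = word_ob w.

Record labeled_box := LabeledBox {
  dom_word : word;
  cod_word : word;
  box_arrow : arrow C;
  src_box : src box_arrow = word_ob dom_word;
  tgt_box : tgt box_arrow = word_ob cod_word
}.

Definition mk_box (X Y : C) (f : hom X Y) (u v : word)
    {eX : is_word X u} {eY : is_word Y v} : labeled_box :=
  @LabeledBox u v (Arrow f) eX eY.

Definition empty_box : labeled_box :=
  @LabeledBox [::] [::] (gid base) erefl erefl.

End Words.

Arguments mk_box {C atoms X Y} f {u v eX eY}.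

Record signature (C : strictMonoidal) := Signature {
  sig_atoms : seq C;
  sig_boxes : seq (labeled_box sig_atoms)
}.

(* The layer [(k, b)] applies the box [b] to the wires from position [k] on. *)
Definition layer := (nat * nat)%type.

(* Layers are listed from the input to the output. *)
Definition diagram := seq layer.

Definition shift (k : nat) (D : diagram) : diagram :=
  [seq (k + l.1, l.2) | l <- D].

Inductive expr :=
  | Wires of word
  | Box of nat
  | Comp of expr & expr
  | Tens of expr & expr.

(** * Diagrams and their denotation *)

Section Diagrams.
Variables (C : strictMonoidal) (S : signature C).
Implicit Types (u v w x y : word) (D E M R : diagram) (F G : arrow C).

Local Notation ob := (word_ob (sig_atoms S)).
Local Notation idw w := (gid (ob w)).

Definition box b := nth (empty_box _) (sig_boxes S) b.
Definition dom b := dom_word (box b).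
Definition cod b := cod_word (box b).
Definition sem b := box_arrow (box b).

Definition whisker u F v := gtens (idw u) (gtens F (idw v)).

Lemma idw_cat u v : idw (u ++ v) = gtens (idw u) (idw v).
Proof. by rewrite gtens_id word_ob_cat. Qed.

Lemma whisker_whisker x u F v y :
  whisker x (whisker u F v) y = whisker (x ++ u) F (v ++ y).
Proof. by rewrite /whisker !idw_cat !gtensA. Qed.

Lemma whisker_id u w v : whisker u (idw w) v = idw (u ++ w ++ v).
Proof. by rewrite !idw_cat. Qed.

Lemma whisker_nil F : whisker [::] F [::] = F.
Proof. by rewrite /whisker gtens1g gtensg1. Qed.

Lemma src_whisker u F v w : src F = ob w ->
  src (whisker u F v) = ob (u ++ w ++ v).
Proof. by move=> /= ->; rewrite !word_ob_cat. Qed.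

Lemma tgt_whisker u F v w : tgt F = ob w ->
  tgt (whisker u F v) = ob (u ++ w ++ v).
Proof. by move=> /= ->; rewrite !word_ob_cat. Qed.

Lemma whisker_comp u G F v : tgt F = src G ->
  whisker u (gcomp G F) v = gcomp (whisker u G v) (whisker u F v).
Proof.
move=> e; rewrite /whisker -!gtens_comp //= ?e //.
by rewrite !gcomp1g.
Qed.

(** Both sides equal [F ⊗ z ⊗ G]; [z] is the word of wires between the two boxes. *)
Lemma whisker_interchange u v F x y G w z :
    src F = ob u -> tgt F = ob v -> src G = ob x -> tgt G = ob y ->
  gcomp (gtens (idw v) (gtens (idw z) G)) (gtens F (gtens (idw z) (idw x))) =
  gcomp (gtens F (gtens (idw z) (idw y))) (gtens (idw u) (gtens (idw z) G)).
Proof.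
move=> sF tF sG tG; rewrite -!gtens_comp //= ?sG ?tG //.
by rewrite !gcomp1g ?gcompg1.
Qed.

(** As a relation, it gives no denotation to a diagram whose layers do not fit the input word, so
    the junk value of [gcomp] never occurs. *)
Inductive denotes : word -> diagram -> word -> arrow C -> Prop :=
  | denotes_nil w : denotes w [::] w (idw w)
  | denotes_cons u b v D w F : denotes (u ++ cod b ++ v) D w F ->
    denotes (u ++ dom b ++ v) ((size u, b) :: D) w
      (gcomp F (whisker u (sem b) v)).

Lemma denotes_inv w l D w' F : denotes w (l :: D) w' F ->
  exists u v F', [/\ w = u ++ dom l.2 ++ v, l.1 = size u,
    denotes (u ++ cod l.2 ++ v) D w' F' & F = gcomp F' (whisker u (sem l.2) v)].
Proof.
move E : (l :: D) => lD d; case: d E => // u b v D' w1 F1 d [-> ->].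
by exists u, v, F1.
Qed.

Lemma denotes_inv_nil w w' F : denotes w [::] w' F -> w' = w /\ F = idw w.
Proof. by move E : [::] => D d; case: d E. Qed.

Lemma src_denotes w D w' F : denotes w D w' F -> src F = ob w.
Proof.
case=> // *; rewrite src_gcomp; apply: src_whisker; exact: src_box.
Qed.

Lemma tgt_denotes w D w' F : denotes w D w' F -> tgt F = ob w'.
Proof.
elim=> // u b v {}D {}w' {}F d IH; rewrite tgt_gcomp // (src_denotes d).
apply: tgt_whisker; exact: tgt_box.
Qed.

Lemma cat_inj u v u' v' : size u = size u' -> u ++ v = u' ++ v' ->
  u = u' /\ v = v'.
Proof. by move=> su /eqP; rewrite eqseq_cat // => /andP[/eqP-> /eqP->]. Qed.

(** The position of a box determines how it splits the current word. *)
Lemma denotes_fun w D w1 F1 w2 F2 :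
  denotes w D w1 F1 -> denotes w D w2 F2 -> w1 = w2 /\ F1 = F2.
Proof.
move=> d; elim: d w2 F2 => {w D w1 F1} [w w2 F2 /denotes_inv_nil[]//|].
move=> u b v D w F _ IH w2 F2 /denotes_inv[u' [v' [F' /=[ew eu d ->]]]].
have [? /(cat_inj erefl)[_ ?]] := cat_inj eu ew; subst u' v'.
by have [-> ->] := IH _ _ d.
Qed.

Lemma denotes_cat w D w1 F1 E w2 F2 :
    denotes w D w1 F1 -> denotes w1 E w2 F2 ->
  denotes w (D ++ E) w2 (gcomp F2 F1).
Proof.
move=> d; elim: d E w2 F2 => {w D w1 F1} [w|u b v D w1 F1 d IH] E w2 F2 e.
  by rewrite gcompg1 ?(src_denotes e).
rewrite gcompA.
- by constructor; apply: IH.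
- rewrite (src_denotes d); apply: tgt_whisker; exact: tgt_box.
- by rewrite (tgt_denotes d) (src_denotes e).
Qed.

Lemma denotes_cat_inv w D E w2 F : denotes w (D ++ E) w2 F ->
  exists w1 F1 F2,
    [/\ denotes w D w1 F1, denotes w1 E w2 F2 & F = gcomp F2 F1].
Proof.
elim: D w F => [|l D IH] w F.
  move=> d; exists w, (idw w), F; split=> //; first by constructor.
  by rewrite gcompg1 ?(src_denotes d).
move=> /denotes_inv[u [v [F' [-> el d ->]]]].
have [w1 [F1 [F2 [d1 d2 ->]]]] := IH _ _ d.
exists w1, (gcomp F1 (whisker u (sem l.2) v)), F2; split=> //.
  by case: l el d d1 {IH} => k b /= -> _ d1; constructor.
rewrite gcompA //.
- rewrite (src_denotes d1); apply: tgt_whisker; exact: tgt_box.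
- by rewrite (tgt_denotes d1) (src_denotes d2).
Qed.

Lemma denotes_shift x y w D w' F : denotes w D w' F ->
  denotes (x ++ w ++ y) (shift (size x) D) (x ++ w' ++ y) (whisker x F y).
Proof.
elim=> {w D w' F} [w|u b v D w F d IH].
  by rewrite whisker_id; constructor.
rewrite whisker_comp; last first.
  rewrite (src_denotes d); apply: tgt_whisker; exact: tgt_box.
have eqw z : x ++ (u ++ z ++ v) ++ y = (x ++ u) ++ z ++ (v ++ y).
  by rewrite !catA.
rewrite whisker_whisker eqw /= -size_cat; constructor.
by rewrite -eqw.
Qed.

(** * Interchange of layers and search for subdiagrams *)

Definition refines D E :=
  forall w w' F, denotes w D w' F -> denotes w E w' F.

Lemma refines_refl D : refines D D. Proof. by []. Qed.

Lemma refines_trans D E M : refines D E -> refines E M -> refines D M.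
Proof. by move=> de em w w' F /de/em. Qed.

Lemma refines_cat D D' E E' : refines D D' -> refines E E' ->
  refines (D ++ E) (D' ++ E').
Proof.
move=> dd ee w w' F /denotes_cat_inv[w1 [F1 [F2 [/dd d /ee e ->]]]].
exact: denotes_cat d e.
Qed.

(** The two tests say that [l'] lies to the right or to the left of the outputs of [l], and they
    keep the truncated subtractions exact. If both hold, [l'] goes to the right. *)
Definition swap (l l' : layer) : option (layer * layer) :=
  let: (k, b) := l in let: (k', b') := l' in
  if k + size (cod b) <= k' then
    Some ((k' - size (cod b) + size (dom b), b'), (k, b))
  else if k' + size (dom b') <= k then
    Some ((k', b'), (k - size (dom b') + size (cod b'), b))
  else None.

Lemma swap_refines l l' m m' : swap l l' = Some (m, m') ->
  refines [:: l; l'] [:: m; m'].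
Proof.
case: l l' => [k b] [k' b'] /= sw w w' F.
move=> /denotes_inv[u [v [F1 /=[-> ek d ->]]]]; subst k.
move: d => /denotes_inv[u' [v' [F2 /=[ew ek' d ->]]]]; subst k'.
move: d => /denotes_inv_nil[-> ->].
rewrite gcomp1g; last by apply: tgt_whisker; apply: tgt_box.
have [sb tb] : src (sem b) = ob (dom b) /\ tgt (sem b) = ob (cod b).
  by split; [apply: src_box|apply: tgt_box].
have [sb' tb'] : src (sem b') = ob (dom b') /\ tgt (sem b') = ob (cod b').
  by split; [apply: src_box|apply: tgt_box].
case: leqP sw => [le [<- <-]|_].
  (* [x] is the word of wires between the outputs of [b] and the inputs of [b']. *)
  have [x eu'] : exists x, u' = u ++ cod b ++ x.
    exists (drop (size u + size (cod b)) u').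
    rewrite -[LHS](cat_take_drop (size u + size (cod b)) u') catA.
    congr (_ ++ _); move/(congr1 (take (size u + size (cod b)))): ew.
    rewrite catA take_size_cat ?size_cat // => ->.
    by rewrite takel_cat.
  subst u'; move: ew; rewrite -!catA => /(cat_inj erefl)[_].
  move=> /(cat_inj erefl)[_ ev]; subst v.
  have -> : size (u ++ cod b ++ x) - size (cod b) + size (dom b) =
      size (u ++ dom b ++ x) by rewrite !size_cat; lia.
  have -> : gcomp (whisker (u ++ cod b ++ x) (sem b') v')
        (whisker u (sem b) (x ++ dom b' ++ v')) =
      gcomp (gcomp (idw (u ++ cod b ++ x ++ cod b' ++ v'))
         (whisker u (sem b) (x ++ cod b' ++ v')))
        (whisker (u ++ dom b ++ x) (sem b') v').
    rewrite gcomp1g; last by apply: tgt_whisker.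
    have e2 z c : whisker (u ++ z ++ x) (sem c) v' =
        whisker u (gtens (idw z) (gtens (idw x) (sem c))) v'.
      by rewrite /whisker !idw_cat !gtensA.
    have e z c : whisker u (sem c) (x ++ z ++ v') =
        whisker u (gtens (sem c) (gtens (idw x) (idw z))) v'.
      by rewrite /whisker !idw_cat !gtensA.
    rewrite !e2 !e -!whisker_comp; try by rewrite /= ?sb ?tb ?sb' ?tb'.
    by congr (whisker _ _ _); apply: whisker_interchange.
  have -> : u ++ dom b ++ x ++ dom b' ++ v' = (u ++ dom b ++ x) ++ dom b' ++ v'.
    by rewrite !catA.
  constructor; rewrite -!catA; constructor; exact: denotes_nil.
case: leqP => // le [<- <-].
have [x eu] : exists x, u = u' ++ dom b' ++ x.
  exists (drop (size u' + size (dom b')) u).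
  rewrite -[LHS](cat_take_drop (size u' + size (dom b')) u) catA.
  congr (_ ++ _); move/(congr1 (take (size u' + size (dom b')))): ew.
  by rewrite takel_cat // => ->; rewrite catA take_size_cat ?size_cat.
subst u; move: ew; rewrite -!catA => /(cat_inj erefl)[_].
move=> /(cat_inj erefl)[_ ev]; subst v'.
have -> : size (u' ++ dom b' ++ x) - size (dom b') + size (cod b') =
    size (u' ++ cod b' ++ x) by rewrite !size_cat; lia.
have -> : gcomp (whisker u' (sem b') (x ++ cod b ++ v))
      (whisker (u' ++ dom b' ++ x) (sem b) v) =
    gcomp (gcomp (idw (u' ++ cod b' ++ x ++ cod b ++ v))
      (whisker (u' ++ cod b' ++ x) (sem b) v))
      (whisker u' (sem b') (x ++ dom b ++ v)).
  rewrite gcomp1g; last by rewrite (tgt_whisker _ _ tb) -!catA.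
  have e2 z c : whisker (u' ++ z ++ x) (sem c) v =
      whisker u' (gtens (idw z) (gtens (idw x) (sem c))) v.
    by rewrite /whisker !idw_cat !gtensA.
  have e z c : whisker u' (sem c) (x ++ z ++ v) =
      whisker u' (gtens (sem c) (gtens (idw x) (idw z))) v.
    by rewrite /whisker !idw_cat !gtensA.
  rewrite !e2 !e -!whisker_comp; try by rewrite /= ?sb ?tb ?sb' ?tb'.
  by congr (whisker _ _ _); apply/esym/whisker_interchange.
constructor.
have eqw z : u' ++ cod b' ++ x ++ z ++ v = (u' ++ cod b' ++ x) ++ z ++ v.
  by rewrite !catA.
rewrite !eqw; constructor; exact: denotes_nil.
Qed.

(* [sink l D] carries [l] past all of [D] towards the output, [raise D l] *)
(* carries it towards the input.                                          *)
Fixpoint sink (l : layer) (D : diagram) : option (diagram * layer) :=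
  if D is m :: D' then
    if swap l m is Some (m', l1) then
      if sink l1 D' is Some (D1, l2) then Some (m' :: D1, l2) else None
    else None
  else Some ([::], l).

Lemma sink_refines l D D' l' : sink l D = Some (D', l') ->
  refines (l :: D) (rcons D' l').
Proof.
elim: D l D' l' => [|m D IH] l D' l' /=; first by case=> <- <-.
case sw : swap => [[m' l1]|] //; case s : sink => [[D1 l2]|] // [<- <-] /=.
apply: (@refines_trans _ (m' :: l1 :: D)).
  exact: refines_cat (swap_refines sw) (@refines_refl D).
exact: refines_cat (@refines_refl [:: m']) (IH _ _ _ s).
Qed.

Fixpoint raise (D : diagram) (l : layer) : option (layer * diagram) :=
  if D is m :: D' then
    if raise D' l is Some (l1, D1) then
      if swap m l1 is Some (l2, m') then Some (l2, m' :: D1) else None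
    else None
  else Some (l, [::]).

Lemma raise_refines D l l' D' : raise D l = Some (l', D') ->
  refines (rcons D l) (l' :: D').
Proof.
elim: D l l' D' => [|m D IH] l l' D' /=; first by case=> <- <-.
case s : raise => [[l1 D1]|] //; case sw : swap => [[l2 m']|] // [<- <-] /=.
apply: (@refines_trans _ (m :: l1 :: D1)).
  exact: refines_cat (@refines_refl [:: m]) (IH _ _ _ s).
exact: refines_cat (swap_refines sw) (@refines_refl D1).
Qed.

(* The layers of [D] on which [l] depends, [l] itself, and the other layers. *)
Fixpoint ancestors (D : diagram) (l : layer) : diagram * layer * diagram :=
  if D is m :: D' then
    let: (B, l1, R) := ancestors D' l in
    if sink m (rcons B l1) is Some (b :: B', m') then
      (belast b B', last b B', m' :: R)
    else (m :: B, l1, R)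
  else ([::], l, [::]).

Lemma ancestors_refines D l B l' R : ancestors D l = (B, l', R) ->
  refines (rcons D l) (B ++ l' :: R).
Proof.
elim: D B l' R => [|m D IH] B l' R /=; first by case=> <- <- <-.
case a : ancestors => [[B1 l1] R1].
have step : refines (m :: rcons D l) (m :: rcons B1 l1 ++ R1).
  rewrite cat_rcons; exact: refines_cat (@refines_refl [:: m]) (IH _ _ _ a).
case s : sink => [[[|b B'] m']|]; try by case=> <- <- <-; rewrite -cat_rcons.
case=> <- <- <-; rewrite -cat_rcons -lastI -cat_rcons.
apply: refines_trans step _.
exact: refines_cat (sink_refines s) (@refines_refl R1).
Qed.

(** Clears ancestors out of the way of the matched part; on failure, no contiguous copy arises from
    this choice of layers. *)
Fixpoint raise_all (M B : diagram) : option (diagram * diagram) :=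
  if B is l :: B' then
    if raise M l is Some (l', M1) then
      if raise_all M1 B' is Some (B1, M2) then Some (l' :: B1, M2) else None
    else None
  else Some ([::], M).

Lemma raise_all_refines M B B' M' : raise_all M B = Some (B', M') ->
  refines (M ++ B) (B' ++ M').
Proof.
elim: B M B' M' => [|l B IH] M B' M' /=; first by case=> <- <-; rewrite cats0.
case s : raise => [[l' M1]|] //; case t : raise_all => [[B1 M2]|] // [<- <-].
apply: (@refines_trans _ (l' :: (M1 ++ B))).
  rewrite -cat_rcons; exact: refines_cat (raise_refines s) (@refines_refl B).
exact: refines_cat (@refines_refl [:: l']) (IH _ _ _ t).
Qed.

(* In a state [(P, M, R)], standing for [P ++ M ++ R], the part matched so far *)
(* is [M].                                                                     *)
Definition state := (diagram * diagram * diagram)%type.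

Definition whole (s : state) : diagram := s.1.1 ++ s.1.2 ++ s.2.

(* Moves layer [j] of [R] to the end of [M] and its ancestors to [P]. *)
Definition extract (s : state) (j : nat) : option state :=
  let: (P, M, R) := s in
  if drop j R is l :: R' then
    let: (B, l', R1) := ancestors (take j R) l in
    if raise_all M B is Some (B', M') then
      Some (P ++ B', rcons M' l', R1 ++ R')
    else None
  else None.

Lemma extract_refines s j s' : extract s j = Some s' ->
  refines (whole s) (whole s').
Proof.
case: s => [[P M] R]; rewrite /extract.
case dR : drop => [//|l R']; case aR : ancestors => [[B l'] R1].
case t : raise_all => [[B' M']|] // [<-]; rewrite /whole /= -!catA.
apply: refines_cat (@refines_refl P) _.
apply: (@refines_trans _ (M ++ (B ++ l' :: R1) ++ R')).
  apply: refines_cat (@refines_refl M) _.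
  rewrite -{1}(cat_take_drop j R) dR -cat_rcons.
  exact: refines_cat (ancestors_refines aR) (@refines_refl R').
rewrite cat_rcons -catA catA [in X in refines _ X]catA.
exact: refines_cat (raise_all_refines t) (@refines_refl _).
Qed.

(* The matched part must be a copy of an initial segment of [L], translated by *)
(* an offset that is read off the first layer.                                 *)
Definition offset (L M : diagram) : nat :=
  (head (0, 0) M).1 - (head (0, 0) L).1.

(** The comparison also rejects the cases in which the subtraction in [offset] truncates. *)
Definition agrees (L : diagram) (s : state) : bool :=
  let M := s.1.2 in M == shift (offset L M) (take (size M) L).

Fixpoint first_extract (L : diagram) (s : state) (js : seq nat) :
    option state :=
  if js is j :: js' then
    if extract s j is Some s' then
      if agrees L s' then Some s' else first_extract L s js'
    else first_extract L s js'
  else None.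

Lemma first_extract_refines L s js s' : first_extract L s js = Some s' ->
  refines (whole s) (whole s').
Proof.
elim: js => //= j js IH; case e : extract => [s1|] //.
by case: agrees => // -[<-]; apply: extract_refines e.
Qed.

Fixpoint complete (L : diagram) (s : state) (n : nat) : option state :=
  if n is n'.+1 then
    if first_extract L s (iota 0 (size s.2)) is Some s' then complete L s' n'
    else None
  else Some s.

Lemma complete_refines L s n s' : complete L s n = Some s' ->
  refines (whole s) (whole s').
Proof.
elim: n s => [s [<-]//|n IH] s /=; case f : first_extract => [s1|] // /IH.
exact: refines_trans (first_extract_refines f).
Qed.

(** The search is greedy once the first layer [j] is chosen; its users try every [j]. *)
Definition matching (L D : diagram) (j : nat) : option state :=
  if extract ([::], [::], D) j is Some s then
    if agrees L s then complete L s (size L).-1 else None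
  else None.

Lemma matching_refines L D j s : matching L D j = Some s -> refines D (whole s).
Proof.
rewrite /matching; case e : extract => [s1|] //; case: agrees => // c.
exact: refines_trans (extract_refines e) (complete_refines c).
Qed.

(** [E] has to match all of [D], untranslated. The empty diagram is set apart because [matching]
    always extracts a layer. *)
Definition same_diagram (D E : diagram) : bool :=
  if E is [::] then D == [::] else
  has (fun j => if matching E D j is Some s then
         [&& s.1.1 == [::], s.1.2 == E & s.2 == [::]] else false)
    (iota 0 (size D)).

Lemma same_diagram_refines D E : same_diagram D E -> refines D E.
Proof.
case: E => [/eqP->|l E] //; rewrite /same_diagram => /hasP[j _].
case m : matching => [[[P M] R]|] //= /and3P[/eqP eP /eqP eM /eqP eR].
by have := matching_refines m; rewrite /whole eP eM eR /= cats0.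
Qed.

(** * Flattening of expressions into diagrams *)

Fixpoint expr_dom (e : expr) : word :=
  match e with
  | Wires w => w
  | Box b => dom b
  | Comp _ f => expr_dom f
  | Tens f g => expr_dom f ++ expr_dom g
  end.

Fixpoint expr_cod (e : expr) : word :=
  match e with
  | Wires w => w
  | Box b => cod b
  | Comp g _ => expr_cod g
  | Tens f g => expr_cod f ++ expr_cod g
  end.

Fixpoint layers (e : expr) : diagram :=
  match e with
  | Wires _ => [::]
  | Box b => [:: (0, b)]
  | Comp g f => layers f ++ layers g
  | Tens f g => layers f ++ shift (size (expr_cod f)) (layers g)
  end.

Fixpoint well_typed (e : expr) : bool :=
  match e with
  | Wires _ | Box _ => true
  | Comp g f => [&& well_typed g, well_typed f & expr_cod f == expr_dom g]
  | Tens f g => well_typed f && well_typed g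
  end.

Fixpoint denotation (e : expr) : arrow C :=
  match e with
  | Wires w => idw w
  | Box b => sem b
  | Comp g f => gcomp (denotation g) (denotation f)
  | Tens f g => gtens (denotation f) (denotation g)
  end.

Lemma layersP e : well_typed e ->
  denotes (expr_dom e) (layers e) (expr_cod e) (denotation e).
Proof.
elim: e => /= [w _|b _|g IHg f IHf|f IHf g IHg].
- exact: denotes_nil.
- have := denotes_cons (denotes_nil ([::] ++ cod b ++ [::])).
  rewrite whisker_nil gcomp1g /= !cats0 //; exact: tgt_box.
- move=> /and3P[/IHg dg /IHf df /eqP e]; rewrite e in df.
  exact: denotes_cat df dg.
move=> /andP[/IHf df /IHg dg].
(* The flattening runs [f] beside the inputs of [g], then [g] beside the outputs of [f]. *)
have -> : gtens (denotation f) (denotation g) =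
    gcomp (whisker (expr_cod f) (denotation g) [::])
      (whisker [::] (denotation f) (expr_dom g)).
  rewrite /whisker gtensg1 gtens1g -gtens_comp ?(src_denotes dg) //=.
    by rewrite gcomp1g ?gcompg1 ?(tgt_denotes df) ?(src_denotes dg).
  exact: tgt_denotes df.
have df' := denotes_shift [::] (expr_dom g) df.
have dg' := denotes_shift (expr_cod f) [::] dg.
rewrite !cats0 in dg'.
have -> : layers f = shift (size (Nil nat)) (layers f).
  by rewrite /shift; elim: layers => //= -[k b] D {1}->.
exact: denotes_cat df' dg'.
Qed.

(** * Rewriting of diagrams by equations of morphisms *)

Class reified (F : arrow C) (e : expr) := reifiedE : F = denotation e.

(* [rule_skip] is the number of occurrences of [rule_lhs] to pass over. *)
Record rule := Rule {
  rule_skip : nat;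
  rule_lhs : expr;
  rule_rhs : expr;
  ruleP : denotation rule_lhs = denotation rule_rhs
}.

(** The proof is abstracted and the definition transparent, so that [vm_compute] sees only the two
    expressions. *)
Definition forward (X X' Y Y' : C) (eX : sameob X X') (eY : sameob Y Y')
    (f : hom X Y) (g : hom X' Y') (h : recast f = g) (e e' : expr)
    {re : reified (Arrow f) e} {re' : reified (Arrow g) e'} : rule.
Proof.
refine (@Rule 0 e e' _); abstract by rewrite -re -re' -h Arrow_recast.
Defined.

Definition backward (X X' Y Y' : C) (eX : sameob X X') (eY : sameob Y Y')
    (f : hom X Y) (g : hom X' Y') (h : recast f = g) (e e' : expr)
    {re : reified (Arrow f) e} {re' : reified (Arrow g) e'} : rule.
Proof.
refine (@Rule 0 e' e _); abstract by rewrite -re -re' -h Arrow_recast.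
Defined.

Definition skip (n : nat) (r : rule) : rule := Rule n (ruleP r).

(** [ruleP] alone does not allow a replacement: different words may denote the same object, and
    ill-typed expressions have junk denotations. *)
Definition rule_ok (r : rule) : bool :=
  [&& well_typed (rule_lhs r), well_typed (rule_rhs r),
      expr_dom (rule_lhs r) == expr_dom (rule_rhs r) &
      expr_cod (rule_lhs r) == expr_cod (rule_rhs r)].

Fixpoint output (w : word) (D : diagram) : word :=
  if D is (k, b) :: D' then
    output (take k w ++ cod b ++ drop (k + size (dom b)) w) D'
  else w.

Lemma outputP w D w' F : denotes w D w' F -> output w D = w'.
Proof.
elim=> //= u b v {}D {}w' {}F _ <-.
by rewrite take_size_cat // [in drop _ _]catA -size_cat drop_size_cat.
Qed.

(** Matching layers only constrains wires that meet a box; idle wires in the domain of a rule are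
    checked here. *)
Definition fits (w u : word) (k : nat) : bool :=
  (k <= size w) && (take (size u) (drop k w) == u).

Lemma fitsP w u k : fits w u k ->
  w = take k w ++ u ++ drop (k + size u) w /\ size (take k w) = k.
Proof.
move=> /andP[kw /eqP eu]; split; last by rewrite size_takel.
by rewrite -[X in _ ++ X ++ _]eu addnC -drop_drop cat_take_drop cat_take_drop.
Qed.

Definition rewrite_at (r : rule) (w : word) (D : diagram) (j : nat) :
    option diagram :=
  let L := layers (rule_lhs r) in
  if matching L D j is Some (P, M, R) then
    let k := offset L M in
    if [&& rule_ok r, M == shift k L &
           fits (output w P) (expr_dom (rule_lhs r)) k]
    then Some (P ++ shift k (layers (rule_rhs r)) ++ R) else None
  else None.

(** By [denotes_fun] the matched part denotes the whiskered left-hand side, for which [ruleP]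
    substitutes the right-hand side. *)
Lemma rewrite_atP r w D j E w' F : rewrite_at r w D j = Some E ->
  denotes w D w' F -> denotes w E w' F.
Proof.
rewrite /rewrite_at; case m : matching => [[[P M] R]|] //.
case: ifP => // /and3P[ok /eqP eM /fitsP[]].
set k := offset _ _; set x := take k _; set y := drop _ _ => ew sx [<-].
move=> /(matching_refines m); rewrite /whole /=.
move=> /denotes_cat_inv[w1 [F1 [F2 [dP dMR ->]]]].
move: dMR => /denotes_cat_inv[w2 [F3 [F4 [dM dR ->]]]].
have ew1 := outputP dP.
have /and4P[/layersP dl /layersP dr /eqP ed /eqP ec] := ok.
have dM' := denotes_shift x y dl.
rewrite sx -eM -ew ew1 in dM'.
have [? ?] := denotes_fun dM dM'; subst w2 F3.
rewrite ruleP ec in dR dM' *.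
have := denotes_shift x y dr; rewrite sx -ed -ew ew1 => dr'.
exact: denotes_cat dP (denotes_cat dr' dR).
Qed.

(** The extra [some] lets [nth] return [None] when there are too few occurrences to skip. *)
Definition rewrite_once (r : rule) (w : word) (D : diagram) : option diagram :=
  nth None (pmap (fun j => omap some (rewrite_at r w D j)) (iota 0 (size D)))
    (rule_skip r).

Lemma rewrite_onceP r w D E w' F : rewrite_once r w D = Some E ->
  denotes w D w' F -> denotes w E w' F.
Proof.
rewrite /rewrite_once; elim: iota (rule_skip r) => [|j js IH] n /=.
  by rewrite nth_nil.
case s : rewrite_at => [E'|] //=; case: n => [|n] /=; do ?exact: IH.
by case=> <-; apply: rewrite_atP s.
Qed.

Fixpoint rewrites (w : word) (D : diagram) (rs : seq rule) : option diagram :=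
  if rs is r :: rs' then
    if rewrite_once r w D is Some E then rewrites w E rs' else None
  else Some D.

Lemma rewritesP w D rs E w' F : rewrites w D rs = Some E ->
  denotes w D w' F -> denotes w E w' F.
Proof.
elim: rs D => [|r rs IH] D /=; first by case=> <-.
by case f : rewrite_once => [D'|] // s /(rewrite_onceP f); apply: IH.
Qed.

Definition joins (e : expr) (rs : seq rule) (e' : expr) (rs' : seq rule) :
    bool :=
  [&& well_typed e, well_typed e', expr_dom e == expr_dom e' &
   match rewrites (expr_dom e) (layers e) rs,
         rewrites (expr_dom e') (layers e') rs' with
   | Some D, Some D' => same_diagram D D'
   | _, _ => false
   end].

Lemma joinsP e rs e' rs' : joins e rs e' rs' -> denotation e = denotation e'.
Proof.
move=> /and4P[/layersP d /layersP d' /eqP ed].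
case s : rewrites => [D|//]; case s' : rewrites => [D'|//].
move=> /same_diagram_refines DD'; rewrite -ed in s' d'.
have [_ //] := denotes_fun (DD' _ _ _ (rewritesP s d)) (rewritesP s' d').
Qed.

(* The rules [rs] are applied in turn to [f] and [rs'] to [g], each where it    *)
(* first matches, and the results are compared up to interchange.               *)
Lemma diagrammatic (rs rs' : seq rule) (X X' Y Y' : C) (eX : sameob X X')
    (eY : sameob Y Y') (f : hom X Y) (g : hom X' Y') (e e' : expr)
    (re : reified (Arrow f) e) (re' : reified (Arrow g) e') :
  joins e rs e' rs' -> recast f = g.
Proof. by move=> /joinsP ee'; apply: eq_recast; rewrite re re' ee'. Qed.

End Diagrams.

Arguments diagrammatic {C S} rs rs' {X X' Y Y' eX eY f g e e' re re'} _.

(** * Reification of morphisms as expressions *)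

Section Reification.
Variable C : strictMonoidal.

#[export] Instance atom_index_head (X : C) s : atom_index X (X :: s) 0.
Proof. by []. Qed.

#[export] Instance atom_index_tail (X Y : C) s n :
  atom_index X s n -> atom_index X (Y :: s) n.+1.
Proof. by []. Qed.

#[export] Instance is_word_atom (atoms : seq C) (X : C) n :
  atom_index X atoms n -> is_word atoms X [:: n] | 1.
Proof. by move=> <-; rewrite /is_word /= tenso1. Qed.

#[export] Instance is_word_tens (atoms : seq C) (X Y : C) u v :
  is_word atoms X u -> is_word atoms Y v ->
  is_word atoms (X ⊗ Y)%ob (u ++ v) | 2.
Proof. by move=> -> ->; rewrite /is_word word_ob_cat. Qed.

#[export] Instance is_word_base (atoms : seq C) : is_word atoms base [::] | 1.
Proof. by []. Qed.

Variable S : signature C.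

Lemma reified_box F n : box_arrow (nth (empty_box _) (sig_boxes S) n) = F ->
  reified S F (Box n).
Proof. by move=> h; rewrite /reified /= -h. Qed.

Lemma reified_id (X : C) w :
  is_word (sig_atoms S) X w -> reified S (Arrow (idm X)) (Wires w).
Proof. by move=> e; rewrite /reified /= -e. Qed.

Lemma reified_scomp (X Y Y' Z : C) (e : sameob Y Y')
    (g : hom Y' Z) (f : hom X Y) eg ef :
  reified S (Arrow g) eg -> reified S (Arrow f) ef ->
  reified S (Arrow (g ∘ f)) (Comp eg ef).
Proof. by move=> rg rf; rewrite /reified Arrow_scomp rg rf. Qed.

Lemma reified_compm (X Y Z : C) (g : hom Y Z) (f : hom X Y) eg ef :
  reified S (Arrow g) eg -> reified S (Arrow f) ef ->
  reified S (Arrow (compm g f)) (Comp eg ef).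
Proof. by move=> rg rf; rewrite /reified Arrow_compm rg rf. Qed.

Lemma reified_tensm (X Y X' Y' : C) (f : hom X Y) (g : hom X' Y') ef eg :
  reified S (Arrow f) ef -> reified S (Arrow g) eg ->
  reified S (Arrow (f ⊗ g)) (Tens ef eg).
Proof. by rewrite /reified /= => <- <-. Qed.

Lemma reified_recast (X Y X' Y' : C) (eX : sameob X X')
    (eY : sameob Y Y') (f : hom X Y) e :
  reified S (Arrow f) e -> reified S (Arrow (recast f)) e.
Proof. by rewrite /reified Arrow_recast. Qed.

End Reification.

Section ReifyBraiding.
Variables (C : strictBraided) (S : signature C) (X Y Z : C).

(** c = (d ∘ c) ∘ c = d ∘ c = id. The hexagon axioms make the braiding with K idempotent, so this
    shows that it is an identity. *)
Lemma left_inverse_idempotent_gid (c d : arrow C) :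
    src c = tgt c -> src d = tgt c -> gcomp d c = gid (src c) ->
  gcomp c c = c -> c = gid (src c).
Proof.
move=> sc sd dc cc.
by rewrite -dc -{2}cc gcompA // dc gcomp1g.
Qed.

Lemma braid_base_l : Arrow (braid base X) = Arrow (idm X).
Proof.
have e := tens1o X; have e' := tenso1 X.
rewrite -[RHS]/(gid X) -[in RHS]e.
apply: (@left_inverse_idempotent_gid _ (Arrow (braid_inv base X))).
- by rewrite /= e e'.
- by [].
- have := congr1 (@Arrow C _ _) (braidK base X).
  by rewrite Arrow_recast Arrow_scomp.
- have := congr1 (@Arrow C _ _) (braid_tensl base base X).
  rewrite Arrow_recast Arrow_scomp (tens1o base) => {3}->.
  exact: congr2 (esym (gtensg1 _)) (esym (gtens1g _)).
Qed.

Lemma braid_base_r : Arrow (braid X base) = Arrow (idm X).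
Proof.
have e := tens1o X; have e' := tenso1 X.
rewrite -[RHS]/(gid X) -[in RHS]e'.
apply: (@left_inverse_idempotent_gid _ (Arrow (braid_inv X base))).
- by rewrite /= e e'.
- by [].
- have := congr1 (@Arrow C _ _) (braidK X base).
  by rewrite Arrow_recast Arrow_scomp.
- have := congr1 (@Arrow C _ _) (braid_tensr X base base).
  rewrite Arrow_recast Arrow_scomp (tens1o base) => {3}->.
  exact: congr2 (esym (gtens1g _)) (esym (gtensg1 _)).
Qed.

Lemma reified_braid_basel e : reified S (Arrow (idm X)) e ->
  reified S (Arrow (braid base X)) e.
Proof. by rewrite braid_base_l. Qed.

Lemma reified_braid_baser e : reified S (Arrow (idm X)) e ->
  reified S (Arrow (braid X base)) e.
Proof. by rewrite braid_base_r. Qed.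

Lemma reified_braid_tensl e :
  reified S (Arrow ((braid X Z ⊗ Y) ∘ (X ⊗ braid Y Z))) e ->
  reified S (Arrow (braid (X ⊗ Y)%ob Z)) e.
Proof. by rewrite -braid_tensl Arrow_recast. Qed.

Lemma reified_braid_tensr e :
  reified S (Arrow ((Y ⊗ braid X Z) ∘ (braid X Y ⊗ Z))) e ->
  reified S (Arrow (braid X (Y ⊗ Z)%ob)) e.
Proof. by rewrite -braid_tensr Arrow_recast. Qed.

End ReifyBraiding.

Ltac find_box f bs :=
  lazymatch eval hnf in bs with
  | cons (mk_box f) _ => constr:(0)
  | cons _ ?bs' => let n := find_box f bs' in constr:(n.+1)
  end.

(** [psi_of] and [sigma_of] stay boxes, opened one occurrence at a time by [psi_ofE] and
    [sigma_ofE]; braidings are resolved into those of atoms. *)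
Ltac reify :=
  lazymatch goal with
  | |- reified ?S (Arrow ?f) _ =>
    lazymatch f with
    | idm _ => simple eapply reified_id; typeclasses eauto
    | scomp _ _ => simple eapply reified_scomp; reify
    | compm _ _ => simple eapply reified_compm; reify
    | tensm _ _ => simple eapply reified_tensm; reify
    | nabla _ => unfold nabla; reify
    | beta _ => unfold beta; reify
    | wcp_mul _ _ => unfold wcp_mul; reify
    | nabla_preunit _ _ => unfold nabla_preunit; reify
    | comul2 _ => unfold comul2; reify
    | recast _ => simple eapply reified_recast; reify
    | braid base _ => simple eapply reified_braid_basel; reify
    | braid _ base => simple eapply reified_braid_baser; reify
    | braid (tens _ _) _ => simple eapply reified_braid_tensl; reify
    | braid _ (tens _ _) => simple eapply reified_braid_tensr; reify
    | _ =>
      let n := find_box f (sig_boxes S) in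
      exact (@reified_box _ S (Arrow f) n erefl)
    end
  end.

#[export] Hint Extern 0 (reified _ _ _) => reify : typeclass_instances.

Lemma mul_assoc (C : strictMonoidal) (A : algebra C) :
  μ_ A ∘ (μ_ A ⊗ A) ≡ μ_ A ∘ (A ⊗ μ_ A).
Proof. exact: is_alg_assoc (algP A). Qed.

Lemma mul_unitl (C : strictMonoidal) (A : algebra C) :
  μ_ A ∘ (η_ A ⊗ A) ≡ idm A.
Proof. exact: is_alg_unitl (algP A). Qed.

Lemma mul_unitr (C : strictMonoidal) (A : algebra C) :
  μ_ A ∘ (A ⊗ η_ A) ≡ idm A.
Proof. exact: is_alg_unitr (algP A). Qed.

(** * Preunits and weak crossed products *)

Section Preunit.
Variables (C : strictMonoidal) (B : C) (m : hom (B ⊗ B) B) (nu : hom base B).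

Definition preunit_sig (e : hom B B) :=
  @Signature C [:: B] [:: mk_box m; mk_box nu; mk_box e].

(** By associativity, x(νν) = (xν)ν = e(e(x)) = e(x). *)
Lemma idempotent_preunit (e : hom B B) :
    associative_product m -> m ∘ (B ⊗ nu) ≡ e -> m ∘ (nu ⊗ B) ≡ e ->
  compm e e = e -> is_preunit m nu.
Proof.
move=> assoc er el ee; split=> //.
- by refine (diagrammatic (S := preunit_sig e) [:: forward er]
    [:: forward el] _); vm_compute.
by refine (diagrammatic (S := preunit_sig e) [:: forward el]
  [:: backward assoc; forward er; forward er;
      forward (ee : compm e e ≡ e)] _); vm_compute.
Qed.

Hypothesis nu_preunit : is_preunit m nu.

Let assoc : m ∘ (m ⊗ B) ≡ m ∘ (B ⊗ m) := preunit_assoc nu_preunit.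
Let comm := preunit_comm nu_preunit.
Let idem := preunit_idem nu_preunit.

(** (xν)ν = x(νν) = νx = xν. *)
Lemma nabla_preunit_idem :
  compm (nabla_preunit m nu) (nabla_preunit m nu) = nabla_preunit m nu.
Proof.
change (compm (nabla_preunit m nu) (nabla_preunit m nu) ≡ nabla_preunit m nu).
by refine (diagrammatic (S := preunit_sig B) [:: forward assoc; backward idem]
  [:: forward comm] _); vm_compute.
Qed.

Variables (P : C) (i : hom P B) (p : hom B P).
Hypothesis split : is_splitting (nabla_preunit m nu) i p.

Definition split_sig :=
  @Signature C [:: B; P] [:: mk_box m; mk_box nu; mk_box i; mk_box p].

(** Since i ∘ p is right multiplication by ν, associativity pushes it from a product onto a factor
    coming from [i], where p ∘ i = id absorbs it. The unit laws reduce to powers of i ∘ p in the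
    same way. *)
Lemma split_algebra : is_algebra (p ∘ nu) (p ∘ m ∘ (i ⊗ i)).
Proof.
have ip : m ∘ (B ⊗ nu) ≡ compm i p by case: split.
have pi : compm p i ≡ idm P by case: split.
split.
- rewrite /associative_product.
  by refine (diagrammatic (S := split_sig)
    [:: backward ip; forward assoc; forward ip; forward pi; forward assoc]
    [:: backward ip; forward assoc; forward ip; forward pi] _); vm_compute.
- by refine (diagrammatic (S := split_sig)
    [:: backward ip; forward assoc; backward comm; backward comm;
        forward ip; forward ip; forward pi; forward pi; forward pi]
    [::] _); vm_compute.
- by refine (diagrammatic (S := split_sig)
    [:: backward ip; backward idem; backward comm; forward ip; forward pi;
        forward pi]
    [::] _); vm_compute.
Qed.

End Preunit.

Section WeakCrossedProduct.
Variables (C : strictMonoidal) (A : algebra C) (V : C).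
Variable psi : hom (V ⊗ A) (A ⊗ V).

Let assoc := mul_assoc A.
Let unitl := mul_unitl A.

Definition wcp_sig boxes : signature C := @Signature C [:: alg_ob A; V]
  ([:: mk_box μ_ A; mk_box η_ A; mk_box psi] ++ boxes).

Lemma nabla_idem :
    (μ_ A ⊗ V) ∘ (A ⊗ psi) ∘ (psi ⊗ A) ≡ psi ∘ (V ⊗ μ_ A) ->
  compm (nabla psi) (nabla psi) = nabla psi.
Proof.
move=> psi_mul; change (compm (nabla psi) (nabla psi) ≡ nabla psi).
by refine (diagrammatic (S := wcp_sig [::])
  [:: forward assoc; forward psi_mul; forward unitl] [::] _); vm_compute.
Qed.

Variable sigma : hom (V ⊗ V) (A ⊗ V).

Definition wcp_sigma_sig := wcp_sig [:: mk_box sigma].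

(** On the left, the twisted condition carries [psi] past the first [sigma], and the two [sigma]
    then meet in the cocycle condition. On the right, [psi] is distributed over the products in
    [A]. *)
Lemma wcp_mul_assoc :
  weak_crossed_product psi sigma -> associative_product (wcp_mul psi sigma).
Proof.
case=> psi_mul _ twisted cocycle; rewrite /associative_product.
by refine (diagrammatic (S := wcp_sigma_sig)
  [:: skip 1 (forward assoc); forward twisted; skip 1 (forward assoc);
      forward assoc; forward cocycle; forward assoc]
  [:: backward psi_mul; backward psi_mul; forward assoc; forward assoc;
      forward assoc; forward assoc] _); vm_compute.
Qed.

Variable nu : hom base (A ⊗ V).

Definition wcp_nu_sig := wcp_sig [:: mk_box sigma; mk_box nu].

Lemma wcp_mul_preunitr :
    (μ_ A ⊗ V) ∘ (A ⊗ sigma) ∘ (psi ⊗ V) ∘ (V ⊗ nu) ≡ nabla psi ∘ (η_ A ⊗ V) ->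
  wcp_mul psi sigma ∘ (idm (A ⊗ V)%ob ⊗ nu) ≡ nabla psi.
Proof.
move=> sigma_right.
by refine (diagrammatic (S := wcp_nu_sig)
  [:: forward assoc; forward sigma_right; forward unitl] [::] _); vm_compute.
Qed.

Lemma wcp_mul_preunitl :
    (μ_ A ⊗ V) ∘ (A ⊗ sigma) ∘ (nu ⊗ V) ≡ nabla psi ∘ (η_ A ⊗ V) ->
    (μ_ A ⊗ V) ∘ (A ⊗ psi) ∘ (nu ⊗ A) ≡ beta nu ->
  wcp_mul psi sigma ∘ (nu ⊗ idm (A ⊗ V)%ob) ≡ nabla psi.
Proof.
move=> sigma_left psi_nu.
by refine (diagrammatic (S := wcp_nu_sig)
  [:: forward psi_nu; forward assoc; forward sigma_left; forward unitl]
  [::] _); vm_compute.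
Qed.

Lemma wcp_preunit :
    weak_crossed_product_with_preunit psi sigma nu ->
  is_preunit (wcp_mul psi sigma) nu.
Proof.
case=> W sigma_right sigma_left psi_nu.
apply: (@idempotent_preunit _ _ _ _ (nabla psi)).
- exact: wcp_mul_assoc.
- exact: wcp_mul_preunitr.
- exact: wcp_mul_preunitl.
- exact: nabla_idem (wcp_psi_mul W).
Qed.

End WeakCrossedProduct.

(** * Twisted partial actions *)

Section HopfAlgebra.
Variables (C : strictBraided) (H : hopfAlgebra C) (A : algebra C).
Variables (phi : hom (H ⊗ A) A) (omega : hom (H ⊗ H) A).

Local Notation psi := (psi_of phi).
Local Notation sigma := (sigma_of omega).

Definition hopf_sig boxes : signature C :=
  @Signature C [:: alg_ob (hopf_alg H); alg_ob A]
    ([:: mk_box η_ H; mk_box μ_ H; mk_box δ_ H; mk_box η_ A; mk_box μ_ A;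
         mk_box c_(H, H); mk_box c_(H, A)] ++ boxes).

Definition psi_sig := hopf_sig [:: mk_box phi; mk_box psi].

Definition sigma_sig := hopf_sig [:: mk_box omega; mk_box sigma].

Definition tpa_sig :=
  hopf_sig [:: mk_box phi; mk_box omega; mk_box psi; mk_box sigma].

Lemma psi_ofE : psi ≡ (phi ⊗ H) ∘ (H ⊗ c_(H, A)) ∘ (δ_ H ⊗ A).
Proof. by apply: eq_recast; rewrite Arrow_recast. Qed.

Lemma sigma_ofE :
  sigma ≡ (omega ⊗ μ_ H) ∘ ((H ⊗ c_(H, H) ⊗ H) ∘ (δ_ H ⊗ δ_ H)).
Proof.
apply: eq_recast; rewrite Arrow_recast Arrow_scomp [RHS]Arrow_scomp.
by rewrite Arrow_recast.
Qed.

Let coassoc := is_coalg_coassoc (hopf_coalgP H).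
Let assocH := mul_assoc H.
Let unitlH := mul_unitl H.
Let unitrH := mul_unitr H.
Let unitlA := mul_unitl A.
Let unitrA := mul_unitr A.
Let natl (X X' Y : C) (f : hom X X') := braid_nat f (idm Y).
Let natr (X Y Y' : C) (g : hom Y Y') := braid_nat (idm X) g.

Lemma psi_colinear :
  (A ⊗ δ_ H) ∘ psi ≡ (psi ⊗ H) ∘ (H ⊗ c_(H, A)) ∘ (δ_ H ⊗ A).
Proof.
by refine (diagrammatic (S := psi_sig)
  [:: forward psi_ofE; forward (natl A δ_ H); backward coassoc]
  [:: forward psi_ofE] _); vm_compute.
Qed.

Lemma sigma_colinear : (A ⊗ δ_ H) ∘ sigma ≡ (sigma ⊗ μ_ H) ∘ comul2 H.
Proof.
by refine (diagrammatic (S := sigma_sig)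
  [:: forward sigma_ofE; forward (comul_mul H); forward (natl H δ_ H);
      backward coassoc; backward coassoc]
  [:: forward sigma_ofE; forward (natr H δ_ H)] _); vm_compute.
Qed.

Hypothesis tpa : twisted_partial_action phi omega.

Lemma tpa_psi_mul :
  (μ_ A ⊗ H) ∘ (A ⊗ psi) ∘ (psi ⊗ A) ≡ psi ∘ (H ⊗ μ_ A).
Proof.
by refine (diagrammatic (S := tpa_sig)
  [:: skip 1 (forward psi_ofE); forward psi_colinear; forward psi_ofE;
      backward (tpa_mul tpa)]
  [:: forward psi_ofE; backward (natr H μ_ A)] _); vm_compute.
Qed.

Lemma tpa_nabla_sigma : nabla psi ∘ sigma ≡ sigma.
Proof.
by refine (diagrammatic (S := tpa_sig)
  [:: forward psi_ofE; forward sigma_colinear; backward (natr H η_ A);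
      backward (tpa_omega tpa)]
  [:: forward sigma_ofE] _); vm_compute.
Qed.

Lemma tpa_wcp_twisted :
  (μ_ A ⊗ H) ∘ (A ⊗ psi) ∘ (sigma ⊗ A) ≡
  (μ_ A ⊗ H) ∘ (A ⊗ sigma) ∘ (psi ⊗ H) ∘ (H ⊗ psi).
Proof.
by refine (diagrammatic (S := tpa_sig)
  [:: forward psi_ofE; forward sigma_colinear; backward (natl A μ_ H);
      backward (tpa_twisted tpa)]
  [:: forward sigma_ofE; forward psi_colinear; forward psi_colinear;
      backward (natr H psi)] _); vm_compute.
Qed.

Hypothesis coc : partial_cocycle phi omega.

Lemma tpa_wcp_cocycle :
  (μ_ A ⊗ H) ∘ (A ⊗ sigma) ∘ (sigma ⊗ H) ≡
  (μ_ A ⊗ H) ∘ (A ⊗ sigma) ∘ (psi ⊗ H) ∘ (H ⊗ sigma).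
Proof.
by refine (diagrammatic (S := tpa_sig)
  [:: skip 1 (forward sigma_ofE); forward sigma_colinear;
      (* The [H] output carries a triple product, bracketed differently on the two sides. *)
      backward (natl H μ_ H); backward coc; forward assocH]
  [:: skip 1 (forward sigma_ofE); forward psi_colinear;
      forward sigma_colinear; backward (natr H sigma)] _); vm_compute.
Qed.

Lemma tpa_wcp : weak_crossed_product psi sigma.
Proof.
split; [exact: tpa_psi_mul | exact: tpa_nabla_sigma |
  exact: tpa_wcp_twisted | exact: tpa_wcp_cocycle].
Qed.

Hypothesis unit_r : omega ∘ (H ⊗ η_ H) ≡ phi ∘ (H ⊗ η_ A).
Hypothesis unit_l : omega ∘ (η_ H ⊗ H) ≡ phi ∘ (H ⊗ η_ A).

(** As δ(1) = 1 ⊗ 1, naturality turns the braiding into one with K, an identity; the unit condition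
    then acts on the [A] output and the unit law on the [H] output. *)
Lemma sigma_unitr : sigma ∘ (H ⊗ η_ H) ≡ psi ∘ (H ⊗ η_ A).
Proof.
by refine (diagrammatic (S := tpa_sig)
  [:: forward sigma_ofE; forward (comul_unit H); backward (natr H η_ H);
      forward unit_r; forward unitrH]
  [:: forward psi_ofE; backward (natr H η_ A)] _); vm_compute.
Qed.

Lemma sigma_unitl : sigma ∘ (η_ H ⊗ H) ≡ psi ∘ (H ⊗ η_ A).
Proof.
by refine (diagrammatic (S := tpa_sig)
  [:: forward sigma_ofE; forward (comul_unit H); backward (natl H η_ H);
      forward unit_l; forward unitlH]
  [:: forward psi_ofE; backward (natr H η_ A)] _); vm_compute.
Qed.

Lemma psi_unit : psi ∘ (η_ H ⊗ A) ≡ A ⊗ η_ H.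
Proof.
by refine (diagrammatic (S := tpa_sig)
  [:: forward psi_ofE; forward (comul_unit H); backward (natl A η_ H);
      forward (tpa_unit tpa)] [::] _); vm_compute.
Qed.

Lemma tpa_wcp_preunit :
  weak_crossed_product_with_preunit psi sigma (recast (η_ A ⊗ η_ H)).
Proof.
split; first exact: tpa_wcp.
(* Replacing [sigma] by [psi] leaves two [psi] acting on η ⊗ η, which multiplicativity merges into
   one. *)
- by refine (diagrammatic (S := tpa_sig)
    [:: forward sigma_unitr; forward tpa_psi_mul; forward unitlA]
    [:: forward unitlA] _); vm_compute.
- by refine (diagrammatic (S := tpa_sig)
    [:: forward sigma_unitl; forward unitlA] [:: forward unitlA] _); vm_compute.
- by refine (diagrammatic (S := tpa_sig)
    [:: forward psi_unit; forward unitlA] [:: forward unitrA] _);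
  vm_compute.
Qed.

End HopfAlgebra.

Theorem mainTheorem2 (C : strictBraided) (Csplit : idempotents_split C)
    (H : hopfAlgebra C) (A : algebra C)
    (phi : hom (H ⊗ A) A) (omega : hom (H ⊗ H) A)
    (tpa : twisted_partial_action phi omega)
    (coc : partial_cocycle phi omega)
    (unit_r : omega ∘ (H ⊗ η_ H) ≡ phi ∘ (H ⊗ η_ A))
    (unit_l : omega ∘ (η_ H ⊗ H) ≡ phi ∘ (H ⊗ η_ A)) :
  let psi : hom (H ⊗ A) (A ⊗ H) := psi_of phi in
  let sigma : hom (H ⊗ H) (A ⊗ H) := sigma_of omega in
  let muAH : hom ((A ⊗ H) ⊗ (A ⊗ H)) (A ⊗ H) := wcp_mul psi sigma in
  let nu : hom base (A ⊗ H) := recast (η_ A ⊗ η_ H) in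
  is_preunit muAH nu /\
  weak_crossed_product_with_preunit psi sigma nu /\
  nabla_preunit muAH nu = nabla psi /\
  (exists (AxH : C) (i : hom AxH (A ⊗ H)) (p : hom (A ⊗ H) AxH),
     is_splitting (nabla psi) i p) /\
  (forall (AxH : C) (i : hom AxH (A ⊗ H)) (p : hom (A ⊗ H) AxH),
     is_splitting (nabla psi) i p ->
     is_algebra (p ∘ nu) (p ∘ muAH ∘ (i ⊗ i))).
Proof.
move=> psi sigma muAH nu.
have wcp : weak_crossed_product_with_preunit psi sigma nu.
  exact: tpa_wcp_preunit.
have preunit : is_preunit muAH nu by apply: wcp_preunit.
have nablaE : nabla_preunit muAH nu = nabla psi.
  exact: wcp_mul_preunitr (wcpp_sigma_right wcp).
split=> //; split=> //; split=> //; split.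
  by apply: Csplit; rewrite -nablaE; apply: nabla_preunit_idem.
by move=> AxH i p; rewrite -nablaE; apply: split_algebra.
Qed.
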